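(* Let $\mathfrak{M}$ be an $n$-model and $\mathfrak{N}$ a finite rooted $n$-model. Then $\mathfrak{M}\not\models\beta(\mathfrak{N})$ if and only if $\mathfrak{M}\leq\mathfrak{N}_{\mathsf t}$ (that is, there is a color-preserving monotonic map from the unraveling $\mathfrak{N}_{\mathsf t}$ into $\mathfrak{M}$). In particular, for any (Kripke or descriptive) frame $\mathfrak{F}$, we have $\mathfrak{F}\not\models\beta(\mathfrak{N})$ if and only if $\mathfrak{M}\leq\mathfrak{N}_{\mathsf t}$ for some $n$-model $\mathfrak{M}$ on $\mathfrak{F}$.
   Context: Formulas are built from propositional variables and $\bot$ by $\wedge,\vee,\to$. A Kripke frame is $(W,R)$ with $W\neq\emptyset$ and $R$ a partial order. A general frame is $(W,R,\mathcal P)$ with $(W,R)$ a Kripke frame and $\mathcal P$ a set of upsets containing $\emptyset,W$, closed under $\cup,\cap$ and $U_0\to U_1:=\{w\mid \forall v\,(wRv\text{ and }v\in U_0\text{ imply }v\in U_1)\}$. It is refined if $\neg wRv$ implies there is $U\in\mathcal P$ with $w\in U$, $v\notin U$; it is compact if every $\mathcal X\subseteq\mathcal P\cup\{W\setminus U\mid U\in\mathcal P\}$ with the finite intersection property has $\bigcap\mathcal X\ne\emptyset$; it is descriptive if it is refined and compact. A Kripke frame is regarded as a general frame with $\mathcal P$ the set of all upsets. A model is a (Kripke or descriptive) frame with a valuation $V$ such that $V(p)\in\mathcal P$ for each variable $p$; truth at a world is the standard intuitionistic Kripke semantics. $\mathfrak M\models\varphi$ means $\varphi$ is true at all worlds of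 $\mathfrak M$; $\mathfrak F\models\varphi$ means $\mathfrak M\models\varphi$ for all models $\mathfrak M$ on $\mathfrak F$. An $n$-model is a model whose valuation is restricted to $n$ fixed variables $p_1,\dots,p_n$. The color $col(w)\in\{0,1\}^n$ of a world $w$ in an $n$-model is the sequence whose $k$-th entry is $1$ iff $p_k$ is true at $w$. A color-preserving monotonic map $f:\mathfrak N\to\mathfrak M$ between $n$-models is a function on worlds with $wRu\Rightarrow f(w)R'f(u)$ and $col(f(w))=col(w)$. We write $\mathfrak M\leq\mathfrak N$ if there is a color-preserving monotonic map from $\mathfrak N$ to $\mathfrak M$ (note the direction). For a finite $n$-model $\mathfrak N$ and a world $w$, let $prop(w)$ be the set of those $p_i$ ($1\le i\le n$) true at $w$ and $notprop(w)$ the set of those $p_i$ not true at $w$. The formula $\beta(w)$ is defined by induction on the depth of $w$ by $\beta(w):=\bigwedge prop(w)\to\bigvee notprop(w)\vee\bigvee_{i=1}^k\beta(w_i)$, where $w_1,\dots,w_k$ are all immediate successors of $w$ (for $w$ maximal, $\beta(w):=\bigwedge prop(w)\to\bigvee notprop(w)$). Empty conjunctions are true, empty disjunctions are $\bot$. If $\mathfrak N$ is rooted with root $r$, $\beta(\mathfrak N):=\beta(r)$. For a finite rooted model $\mathfrak N$ with root $r$, the unraveling $\mathfrak N_{\mathsf t}$ is the finite tree model whose worlds are the sequences $\langle r,w_1,\dots,w_k\rangle$ ($k\ge 0$) in which each entry is an immediate successor of the previous one, ordered by the initial segment relation, with each sequence having the color of its last entry. *)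

(* Defs.v *)
From HB Require Import structures.
From mathcomp Require Import all_boot all_order.
From mathcomp Require Import boolp classical_sets cardinality.

Set Implicit Arguments.
Unset Strict Implicit.
Unset Printing Implicit Defensive.

Local Open Scope classical_set_scope.

(** * Formulas *)

Inductive form (X : Type) : Type :=
| Var of X
| Bot
| And of form X & form X
| Or of form X & form X
| Imp of form X & form X.

Arguments Bot {X}.

Definition Top {X : Type} : form X := Imp Bot Bot.

Definition bigAnd (X : Type) (s : seq (form X)) : form X := foldr (@And X) Top s.
Definition bigOr (X : Type) (s : seq (form X)) : form X := foldr (@Or X) Bot s.

Fixpoint rename (X Y : Type) (f : X -> Y) (phi : form X) : form Y :=
  match phi with
  | Var p => Var (f p)
  | Bot => Bot
  | And a b => And (rename f a) (rename f b)
  | Or a b => Or (rename f a) (rename f b)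
  | Imp a b => Imp (rename f a) (rename f b)
  end.

(* The variables of the full language are indexed by nat, and those of an
   n-model by 'I_n; a formula in the latter is a formula of the full language. *)
Definition full_form (n : nat) (phi : form 'I_n) : form nat :=
  rename (@nat_of_ord n) phi.

(** * Frames *)

Record kframe := KFrame {
  world :> Type;
  acc : world -> world -> Prop;
  world_inhabited : inhabited world;
  acc_refl : forall w, acc w w;
  acc_antisym : forall w v, acc w v -> acc v w -> w = v;
  acc_trans : forall w v u, acc w v -> acc v u -> acc w u }.

Definition upset (K : kframe) (U : set K) : Prop :=
  forall w v, acc w v -> U w -> U v.

Definition set_imp (K : kframe) (U0 U1 : set K) : set K :=
  [set w | forall v, acc w v -> U0 v -> U1 v].

Record gframe := GFrame {
  gkframe :> kframe;
  adm : set (set gkframe);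
  adm_upset : forall U, adm U -> upset U;
  adm_set0 : adm set0;
  adm_setT : adm setT;
  adm_setU : forall U0 U1, adm U0 -> adm U1 -> adm (U0 `|` U1);
  adm_setI : forall U0 U1, adm U0 -> adm U1 -> adm (U0 `&` U1);
  adm_imp : forall U0 U1, adm U0 -> adm U1 -> adm (set_imp U0 U1) }.

Definition refined (G : gframe) : Prop :=
  forall w v : G, ~ acc w v -> exists U : set G, [/\ adm U, U w & ~ U v].

Definition finite_intersection_property (T : Type) (X : set (set T)) : Prop :=
  forall Y : set (set T), Y `<=` X -> finite_set Y ->
    \bigcap_(A in Y) A !=set0.

Definition compact (G : gframe) : Prop :=
  forall X : set (set G),
    X `<=` @adm G `|` [set ~` U | U in @adm G] ->
    finite_intersection_property X ->
    \bigcap_(A in X) A !=set0.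

Definition descriptive (G : gframe) : Prop := refined G /\ compact G.

Section KripkeAsGeneral.
Variable K : kframe.

Lemma upset_set0 : upset (set0 : set K).
Proof. by []. Qed.

Lemma upset_setT : upset (setT : set K).
Proof. by []. Qed.

Lemma upset_setU (U0 U1 : set K) : upset U0 -> upset U1 -> upset (U0 `|` U1).
Proof.
by move=> h0 h1 w v wv [/(h0 _ _ wv) | /(h1 _ _ wv)] h; [left | right].
Qed.

Lemma upset_setI (U0 U1 : set K) : upset U0 -> upset U1 -> upset (U0 `&` U1).
Proof. by move=> h0 h1 w v wv [/(h0 _ _ wv) ? /(h1 _ _ wv) ?]. Qed.

Lemma upset_imp (U0 U1 : set K) : upset U0 -> upset U1 -> upset (set_imp U0 U1).
Proof. by move=> _ _ w v wv h u vu; apply: h; apply: acc_trans wv vu. Qed.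

Definition kripke_gframe : gframe :=
  @GFrame K [set U | upset U] (fun _ => id)
    upset_set0 upset_setT upset_setU upset_setI upset_imp.

End KripkeAsGeneral.

Inductive frame : Type :=
| Kripke of kframe
| Descriptive (G : gframe) of descriptive G.

Definition frame_gframe (F : frame) : gframe :=
  match F with
  | Kripke K => kripke_gframe K
  | Descriptive G _ => G
  end.

Coercion frame_gframe : frame >-> gframe.

(** * Models *)

(* A model on F for the variables in X is given by its valuation. *)
Record model (X : Type) (F : frame) := Model {
  valuation : X -> set F;
  valuation_adm : forall p, adm (valuation p) }.

Definition nmodel (n : nat) (F : frame) : Type := model 'I_n F.

Fixpoint forces (X : Type) (F : frame) (M : model X F) (phi : form X) (w : F)
    : Prop :=
  match phi with
  | Var p => valuation M p w
  | Bot => False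
  | And a b => forces M a w /\ forces M b w
  | Or a b => forces M a w \/ forces M b w
  | Imp a b => forall v : F, acc w v -> forces M a v -> forces M b v
  end.

Definition model_valid (X : Type) (F : frame) (M : model X F) (phi : form X)
    : Prop := forall w : F, forces M phi w.

Definition frame_valid (F : frame) (phi : form nat) : Prop :=
  forall M : model nat F, model_valid M phi.

Definition col (n : nat) (F : frame) (M : nmodel n F) (w : F)
    : {ffun 'I_n -> bool} := [ffun k => `[< forces M (Var k) w >]].

Definition cp_monotonic (n : nat) (F' F : frame) (N : nmodel n F')
    (M : nmodel n F) (f : F' -> F) : Prop :=
  (forall w u : F', acc w u -> acc (f w) (f u)) /\
  (forall w : F', col M (f w) = col N w).

(* The map goes from the larger model N to the smaller model M. *)
Definition model_le (n : nat) (F F' : frame) (M : nmodel n F)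
    (N : nmodel n F') : Prop :=
  exists f : F' -> F, cp_monotonic N M f.

(** * Finite rooted models *)

(* On a finite frame, refinedness already makes every upset admissible, so there
   is nothing to choose between Kripke and descriptive: a finite n-model is a
   finite poset with an upset for each variable. *)
Record finite_rooted_nmodel (n : nat) := FiniteRootedNModel {
  fdisp : Order.disp_t;
  fworld :> finPOrderType fdisp;
  fval : 'I_n -> {set fworld};
  fval_upset : forall (k : 'I_n) (w v : fworld),
    (w <= v)%O -> w \in fval k -> v \in fval k;
  root : fworld;
  root_le : forall w : fworld, (root <= w)%O }.

Definition imm_succ (d : Order.disp_t) (W : finPOrderType d) : rel W :=
  fun w v => (w < v)%O && [forall u : W, ~~ ((w < u)%O && (u < v)%O)].

Section Beta.
Variables (n : nat) (N : finite_rooted_nmodel n).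

Definition prop (w : N) : seq 'I_n := [seq k <- enum 'I_n | w \in fval N k].
Definition notprop (w : N) : seq 'I_n := [seq k <- enum 'I_n | w \notin fval N k].
Definition imm_succs (w : N) : seq N := [seq v <- enum N | imm_succ w v].

Definition beta_step (b : N -> form 'I_n) (w : N) : form 'I_n :=
  let vars s := [seq Var k | k <- s] in
  Imp (bigAnd (vars (prop w)))
      (if imm_succs w is [::] then bigOr (vars (notprop w))
       else Or (bigOr (vars (notprop w))) (bigOr [seq b v | v <- imm_succs w])).

(* Recursion on a bound for the depth; beta_worldE below is the recursive
   equation, which shows that the value at bound 0 is never used. *)
Fixpoint beta_rec (m : nat) (w : N) : form 'I_n :=
  if m is m'.+1 then beta_step (beta_rec m') w else Bot.

Definition beta_world (w : N) : form 'I_n := beta_rec #|N| w.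

Lemma eq_beta_step (b b' : N -> form 'I_n) (w : N) :
  (forall v, imm_succ w v -> b v = b' v) -> beta_step b w = beta_step b' w.
Proof.
move=> e; rewrite /beta_step.
have -> // : [seq b v | v <- imm_succs w] = [seq b' v | v <- imm_succs w].
by apply/eq_in_map => v; rewrite mem_filter => /andP[/e].
Qed.

Lemma beta_rec_bound (m m' : nat) (w : N) :
  #|[set v : N | (w <= v)%O]%SET| <= m ->
  #|[set v : N | (w <= v)%O]%SET| <= m' -> beta_rec m w = beta_rec m' w.
Proof.
have pos u : 0 < #|[set v : N | (u <= v)%O]%SET|.
  by apply/card_gt0P; exists u; rewrite !inE Order.POrderTheory.lexx.
elim: m m' w => [|m IH] m' w.
  by move=> h; have := leq_trans (pos w) h.
case: m' => [|m'].
  by move=> _ h; have := leq_trans (pos w) h.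
move=> hm hm'; apply: eq_beta_step => v /andP[wv _].
have lt : #|[set u : N | (v <= u)%O]%SET| < #|[set u : N | (w <= u)%O]%SET|.
  apply/proper_card/properP; split.
    apply/fintype.subsetP => u; rewrite !inE.
    exact: Order.POrderTheory.le_trans (Order.POrderTheory.ltW wv).
  exists w; rewrite !inE ?Order.POrderTheory.lexx //.
  by rewrite Order.POrderTheory.lt_geF.
by apply: IH; rewrite -ltnS; apply: leq_trans lt _.
Qed.

Lemma beta_worldE (w : N) : beta_world w = beta_step beta_world w.
Proof.
rewrite /beta_world [RHS](_ : _ = beta_rec #|N|.+1 w) //.
by apply: beta_rec_bound; [|apply: leqW]; apply: max_card.
Qed.

Definition beta : form 'I_n := beta_world (root N).

End Beta.

(** * Unraveling *)

Section Unravel.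
Variables (n : nat) (N : finite_rooted_nmodel n).

Definition root_path (s : seq N) : bool :=
  (ohead s == Some (root N)) && sorted (@imm_succ _ N) s.

Definition unravel_world : Type := {s : seq N | root_path s}.

Definition unravel_le (s t : unravel_world) : Prop := prefix (val s) (val t).

Definition last_world (s : unravel_world) : N := last (root N) (val s).

Lemma unravel_inhabited : inhabited unravel_world.
Proof.
by constructor; exists [:: root N]; rewrite /root_path /= eqxx.
Qed.

Lemma unravel_refl s : unravel_le s s.
Proof. exact: prefix_refl. Qed.

Lemma unravel_antisym s t : unravel_le s t -> unravel_le t s -> s = t.
Proof.
move=> /prefixP[u eu] /prefixP[v ev]; apply: val_inj => /=.
move: (congr1 size eu) (congr1 size ev); rewrite !size_cat => e1 e2.
have /size0nil u0 : size u = 0.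
  by apply/eqP; rewrite -leqn0 -(leq_add2l (size (val s))) addn0 -e1 e2 leq_addr.
by rewrite eu u0 cats0.
Qed.

Lemma unravel_trans s t u : unravel_le s t -> unravel_le t u -> unravel_le s u.
Proof. exact: prefix_trans. Qed.

Definition unravel_frame : frame :=
  Kripke (KFrame unravel_inhabited unravel_refl unravel_antisym unravel_trans).

Definition unravel_val (k : 'I_n) : set unravel_world :=
  [set s | last_world s \in fval N k].

Lemma last_world_mono s t :
  unravel_le s t -> (last_world s <= last_world t)%O.
Proof.
case: s t => [s hs] [t ht] /prefixP /= [u eu]; rewrite /last_world /=.
case/andP: ht => _; rewrite {t}eu last_cat.
case: s hs => [//|x s] _ /=; rewrite cat_path => /andP[_].
elim: u (last x s) => [|y u IH] z /=; first by rewrite Order.POrderTheory.lexx.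
case/andP=> /andP[zy _] /IH; apply: Order.POrderTheory.le_trans.
exact: Order.POrderTheory.ltW.
Qed.

Lemma unravel_val_adm k : @adm unravel_frame (unravel_val k).
Proof. by move=> s t /last_world_mono; apply: fval_upset. Qed.

Definition unravel : nmodel n unravel_frame :=
  @Model 'I_n unravel_frame unravel_val unravel_val_adm.

End Unravel.

(* Main.v *)
(** A world refutes [beta u] exactly when it sees a world having the color of
    [u] and refuting [beta v] for every immediate successor [v] of [u].
    Iterating this choice along a sequence of immediate successors maps the
    unraveling into the model.  The unraveling is needed because the world
    chosen for [v] depends on the path along which [v] was reached. *)
Require Import Defs.
From mathcomp Require Import all_boot all_order.
From mathcomp Require Import boolp classical_sets.

Set Implicit Arguments.
Unset Strict Implicit.
Unset Printing Implicit Defensive.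

Section Forcing.
Variables (X : Type) (F : frame).
Implicit Types (M : model X F) (w v : F).

Lemma forces_persistent M phi w v :
  acc w v -> forces M phi w -> forces M phi v.
Proof.
elim: phi w v => [p||a IHa b IHb|a IHa b IHb|a _ b _] w v wv //=.
- exact: (adm_upset (valuation_adm M p) wv).
- by case=> /(IHa _ _ wv) ? /(IHb _ _ wv).
- by case=> [/(IHa _ _ wv)|/(IHb _ _ wv)]; [left|right].
- by move=> h u vu; apply: h; apply: acc_trans wv vu.
Qed.

Lemma forces_bigAnd (T : eqType) M (g : T -> form X) (s : seq T) w :
  forces M (bigAnd [seq g x | x <- s]) w <->
  forall x, x \in s -> forces M (g x) w.
Proof.
elim: s => [|x s IH]; first by split=> // _ v _.
rewrite /= IH; split=> [[hx hs] y|h].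
  by rewrite inE => /predU1P[->|/hs].
by split=> [|y ys]; apply: h; rewrite inE ?eqxx ?ys ?orbT.
Qed.

Lemma forces_bigOr (T : eqType) M (g : T -> form X) (s : seq T) w :
  forces M (bigOr [seq g x | x <- s]) w <->
  exists2 x, x \in s & forces M (g x) w.
Proof.
elim: s => [|x s IH]; first by split=> [//|[]].
rewrite /= IH; split=> [[hx|[y ys hy]]|[y]].
- by exists x => //; rewrite inE eqxx.
- by exists y => //; rewrite inE ys orbT.
- by rewrite inE => /predU1P[->|ys] hy; [left|right; exists y].
Qed.

Lemma forces_rename (Y : Type) (g : X -> Y) (L : model Y F) M phi w :
  (forall x, valuation M x = valuation L (g x)) ->
  forces L (rename g phi) w <-> forces M phi w.
Proof.
move=> e; elim: phi w => [p||a IHa b IHb|a IHa b IHb|a IHa b IHb] w //=.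
- by rewrite e.
- by rewrite IHa IHb.
- by rewrite IHa IHb.
- by split=> h v wv /IHa /(h v wv) /IHb.
Qed.

End Forcing.

Section Refutation.
Variables (n : nat) (N : finite_rooted_nmodel n) (F : frame) (M : nmodel n F).
Implicit Types (u v : N) (w x : F).

(** Equality of colors as a pointwise equivalence in [Prop], free of the boolean reflection in
    [col]. *)
Definition same_color u w : Prop :=
  forall k, valuation M k w <-> u \in fval N k.

Lemma col_unravelP (s : unravel_frame N) w :
  col M w = col (unravel N) s <-> same_color (last_world s) w.
Proof.
split=> [/ffunP e k|e].
  by have := e k; rewrite !ffunE => h; exact (asbool_eq_equiv h).
by apply/ffunP => k; rewrite !ffunE; apply: asbool_equiv_eq; apply: e.
Qed.

(** A failed implication has a witness [x] above [w]. The antecedent makes the variables of [u] true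
    at [x], and the failing disjuncts from [notprop u] make the others false there; together they
    fix the color. *)
Lemma refutes_betaP u w :
  ~ forces M (beta_world u) w <->
  exists x, [/\ acc w x, same_color u x &
    forall v, imm_succ u v -> ~ forces M (beta_world v) x].
Proof.
have antecedent x : forces M (bigAnd [seq Var k | k <- prop u]) x <->
    forall k, u \in fval N k -> valuation M k x.
  rewrite forces_bigAnd; split=> h k.
    by move=> uk; apply: h; rewrite mem_filter uk mem_enum.
  by rewrite mem_filter => /andP[/h].
have mem_succs v : (v \in imm_succs u) = imm_succ u v.
  by rewrite mem_filter mem_enum andbT.
have consequent x :
    forces M (if imm_succs u is [::] then bigOr [seq Var k | k <- notprop u]
      else Or (bigOr [seq Var k | k <- notprop u])
              (bigOr [seq beta_world v | v <- imm_succs u])) x <->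
    (exists2 k, u \notin fval N k & valuation M k x) \/
    (exists2 v, imm_succ u v & forces M (beta_world v) x).
  have -> : (exists2 k, u \notin fval N k & valuation M k x) <->
      forces M (bigOr [seq Var k | k <- notprop u]) x.
    rewrite forces_bigOr; split=> -[k uk hk]; exists k => //.
      by rewrite mem_filter uk mem_enum.
    by move: uk; rewrite mem_filter => /andP[].
  have -> : (exists2 v, imm_succ u v & forces M (beta_world v) x) <->
      forces M (bigOr [seq beta_world v | v <- imm_succs u]) x.
    by rewrite forces_bigOr; split=> -[v uv hv]; exists v => //;
      rewrite ?mem_succs // -mem_succs.
  (* For a maximal [u] the omitted disjunct would be [Bot], so both shapes of the formula agree. *)
  by case: (imm_succs u) => [|v s] //=; split=> [|[]]; [left|..].
rewrite beta_worldE /beta_step /=; split.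
  move=> /existsNP[x] /not_implyP[wx] /not_implyP[/antecedent hp].
  rewrite consequent => /not_orP[hn hs]; exists x; split=> //.
    move=> k; split=> [hk|]; last exact: hp.
    by apply/negPn/negP => uk; apply: hn; exists k.
  by move=> v uv hv; apply: hs; exists v.
move=> [x [wx ux hs]] /(_ x wx) h.
have /h/consequent : forces M (bigAnd [seq Var k | k <- prop u]) x.
  by apply/antecedent => k /ux.
by case=> [[k /negP uk /ux]|[v /hs]].
Qed.

Lemma refutes_beta_le w : ~ forces M (beta N) w -> model_le M (unravel N).
Proof.
(* The choice is made total, so that [next u x] always lies above [x]. *)
have /choice[next nextP] : forall p : N * F, exists x, acc p.2 x /\
    (~ forces M (beta_world p.1) p.2 -> same_color p.1 x /\
     forall v, imm_succ p.1 v -> ~ forces M (beta_world v) x).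
  move=> [u x]; have [h|/refutes_betaP[y [xy uy hy]]] :=
    pselect (forces M (beta_world u) x).
    by exists x; split=> //; apply: acc_refl.
  by exists y.
pose walk := foldl (fun x u => next (u, x)).
have acc_walk x s : acc x (walk x s).
  elim: s x => [|u s IH] x /=; first exact: acc_refl.
  exact: acc_trans (nextP (u, x)).1 (IH _).
(* Invariant: the current world refutes [beta_world] of the entry about to be read, so reading it
   leads to a world of its color. *)
have walk_color u s x : path (@imm_succ _ (fworld N)) u s ->
    ~ forces M (beta_world u) x -> same_color (last u s) (walk x (u :: s)).
  elim: s u x => [|v s IH] u x /= us /(nextP (u, x)).2[cu hu] //.
  by case/andP: us => uv vs; apply: IH vs (hu v uv).
(* The root is itself read as a first step from [w], since [w] need not have its color. Monotonicity
   holds because a longer sequence continues the walk of its prefix. *)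
move=> hw; exists (fun s : unravel_frame N => walk w (val s)); split.
  by move=> s t /prefixP[r ->]; rewrite /walk foldl_cat; apply: acc_walk.
case=> s hs; apply/col_unravelP; rewrite /last_world /=.
by case: s hs => [//|u s] /andP[/eqP[->]] /= us; apply: walk_color.
Qed.

Lemma root_path_rcons (s : seq N) v :
  root_path s -> imm_succ (last (Defs.root N) s) v -> root_path (rcons s v).
Proof.
case: s => [//|u s] /andP[hu us] uv.
by rewrite /root_path /= rcons_path hu uv andbT.
Qed.

(** The world [f s] is its own witness in [refutes_betaP]: it has the right color, and each
    immediate successor [v] is handled by the image of [s] extended by [v]. *)
Lemma le_refutes_beta (f : unravel_frame N -> F) (s : unravel_frame N) :
  cp_monotonic (unravel N) M f -> ~ forces M (beta_world (last_world s)) (f s).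
Proof.
move=> [f_mono f_col].
(* This count drops when [s] is extended by [v], since [v] is strictly above the last entry of [s]
   but not above itself. *)
have [m] := ubnP #|[set v : N | (last_world s < v)%O]%SET|.
elim: m s => // m IH s /ltnSE lem.
apply/refutes_betaP; exists (f s); split; first exact: acc_refl.
  exact/col_unravelP.
move=> v sv.
pose t : unravel_frame N :=
  exist (@root_path n N) _ (root_path_rcons (valP s) sv).
have last_t : last_world t = v by rewrite /last_world /= last_rcons.
have st : acc s t by rewrite /= /unravel_le /= -cats1 prefix_prefix.
(* Truth of [beta_world v] at [f s] would persist to [f t], against the induction hypothesis. *)
move=> /(forces_persistent (f_mono _ _ st)); rewrite -last_t; apply: IH.
apply: leq_trans lem; rewrite last_t; have /andP[lt_sv _] := sv.
apply/proper_card/properP; split.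
  apply/fintype.subsetP => u; rewrite !inE.
  exact: Order.POrderTheory.lt_trans lt_sv.
by exists v; rewrite !inE // Order.POrderTheory.ltxx.
Qed.

Lemma not_valid_betaP : ~ model_valid M (beta N) <-> model_le M (unravel N).
Proof.
split=> [/existsNP[w]|[f hf] valid]; first exact: refutes_beta_le.
have hr : root_path [:: Defs.root N] by rewrite /root_path /= eqxx.
exact: (le_refutes_beta (s := exist (@root_path n N) _ hr) hf) (valid _).
Qed.

End Refutation.

Section FullLanguage.
Variables (n : nat) (F : frame).

Definition restrict_model (L : model nat F) : nmodel n F :=
  Model (fun k : 'I_n => valuation_adm L k).

(** The default [set0] is chosen because it is admissible on every frame. *)
Definition extend_val (M : nmodel n F) (p : nat) : set F :=
  if insub p is Some k then valuation M k else set0.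

Lemma extend_val_adm (M : nmodel n F) p : adm (extend_val M p).
Proof.
by rewrite /extend_val; case: insub => [k|];
  [apply: valuation_adm|apply: adm_set0].
Qed.

Definition extend_model (M : nmodel n F) : model nat F :=
  Model (extend_val_adm M).

(** Models of the full language restrict to [n]-models and [n]-models extend to full ones, with
    agreement on all variables that occur in [full_form phi]. *)
Lemma frame_valid_full_form (phi : form 'I_n) :
  frame_valid F (full_form phi) <-> forall M : nmodel n F, model_valid M phi.
Proof.
split=> [valid M w|valid L w].
  apply/(forces_rename (g := @nat_of_ord n) (L := extend_model M)) => [k|].
    by rewrite /= /extend_val valK.
  exact: valid.
by apply/(forces_rename (M := restrict_model L)) => //; apply: valid.
Qed.

End FullLanguage.

Theorem theorem3p3 (n : nat) (N : finite_rooted_nmodel n) :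
  (forall (F : frame) (M : nmodel n F),
     ~ model_valid M (beta N) <-> model_le M (unravel N)) /\
  (forall F : frame,
     ~ frame_valid F (full_form (beta N)) <->
     exists M : nmodel n F, model_le M (unravel N)).
Proof.
split=> [F M|F]; first exact: not_valid_betaP.
rewrite frame_valid_full_form; split=> [/existsNP[M] /not_valid_betaP|[M]].
  by exists M.
by move=> /not_valid_betaP hM valid; apply: hM; apply: valid.
Qed.
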